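(* Let $K \subset X \subset B_n$ be compact basic semialgebraic sets with the given polynomial descriptions $(g_i^K)_i$, $(g_i^X)_i$, satisfying the standing assumptions listed in the context (in particular $0 \in \mathrm{int}\,K$ and the finite Gibbs phenomenon assumption). Then there exist constants $c_1, c_2 > 0$, depending only on $X$ and $K$ (with their descriptions), such that for every constant $c_G$ as in the finite Gibbs phenomenon assumption the following holds. For all $\varepsilon > 0$, setting $c_3(\varepsilon) := \lceil 2c_1/\varepsilon \rceil$, one has $$v_d^\star - \mathrm{vol}\,K < \varepsilon$$ for every $d \in \mathbb{N}$ with $$d \ \ge\ c_2 \exp\left[\left( \frac{3\, c_3(\varepsilon)^2\, (3rn)^{c_3(\varepsilon)}\,\bigl(2 c_G\, \mathrm{vol}\,B_n + \varepsilon\bigr)}{\varepsilon} \right)^{c_2}\right],$$ and, as $\varepsilon \to 0^+$, the right-hand side of this inequality is $$O\left(\exp\left[\frac{1}{\varepsilon^{3c_2}}\,(3rn)^{\frac{2c_1}{\varepsilon}}\right]\right).$$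
   Context: Setting. $B_n := \{x\in\mathbb{R}^n : \|x\|_2 \le 1\}$. The sets $$K := \{x\in\mathbb{R}^n : g_i^K(x)\ge 0,\ i=1,\dots,n_K\},\qquad X := \{x\in\mathbb{R}^n : g_i^X(x)\ge 0,\ i=1,\dots,n_X\}$$ are compact basic semialgebraic sets described by real polynomials $g_i^K, g_i^X\in\mathbb{R}[x]$, with $K\subset X\subset B_n$. Put $g_0^K := g_0^X := 1$. It is assumed that one of the $g_i^K$ with $i>0$, and one of the $g_i^X$ with $i>0$, equals $1-\sum_{k=1}^n x_k^2$. It is assumed that $0\in\mathrm{int}\,K$. $\mathrm{vol}$ denotes Lebesgue measure on $\mathbb{R}^n$, $\int_X p := \int_X p(x)\,dx$, and $I_K$ is the indicator function of $K$ (equal to $1$ on $K$ and $0$ outside). Truncated quadratic modules. Let $\Sigma[x]\subset\mathbb{R}[x]$ be the cone of sums of squares of polynomials and $\mathbb{R}[x]_d$ the space of polynomials of total degree at most $d$. For $S\in\{K,X\}$, $$Q_d(S) := \Bigl\{\sum_{i=0}^{n_S} g_i^S s_i^S : s_i^S\in\Sigma[x],\ \deg(g_i^S s_i^S)\le 2\lfloor d/2\rfloor\Bigr\}.$$ Hierarchy. For $d\in\mathbb{N}$, $$v_d^\star := \inf\Bigl\{\int_X p \ :\ p\in\mathbb{R}[x]_d,\ p-1\in Q_d(K),\ p\in Q_d(X)\Bigr\}.$$ Finite Gibbs phenomenon assumption. There is a sequence $(p_d)_{d\in\mathbb{N}}$ such that, for each $d$, $p_d$ is a minimizer of $\int_X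 (p-I_K)$ over all $p\in\mathbb{R}[x]_d$ with $p\ge I_K$ on $X$, and a finite constant $c_G$ (independent of $d$) such that $\max_{x\in X}p_d(x)\le c_G$ for all $d$. A constant $c_G$ ''as in the finite Gibbs phenomenon assumption'' is any constant for which such a sequence exists. The number $r$ is $$r := \frac{1}{\sup\{s>0 : [-s,s]^n\subset K\}}.$$ *)

(* Defs.v *)
From HB Require Import structures.
From mathcomp Require Import all_boot all_order all_algebra.
From mathcomp Require mpoly.
From mathcomp Require Import all_classical all_reals all_analysis.
(* The notations of mpoly are incompatible with those of the analysis library,
   so only its canonical structures and coercions are imported. *)
Export (canonicals, coercions) mpoly.
Import Order.TTheory GRing.Theory Num.Theory.
Import numFieldNormedType.Exports.

Set Implicit Arguments.
Unset Strict Implicit.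
Unset Printing Implicit Defensive.

Local Open Scope classical_set_scope.
Local Open Scope ring_scope.

(* R^n is 'rV[R]_n, with the library topology (the norm is the sup norm, which
   induces the Euclidean topology) and the sigma-algebra generated by the
   coordinate functions, i.e. the product of the Borel sigma-algebras. *)
Definition measure_rV_display : measure_display.
Proof. exact: default_measure_display. Qed.

Section measurable_rV.
Variables (R : realType) (n : nat).

Definition rV_coord (i : 'I_n) (v : 'rV[R]_n) : measurableTypeR R := v ord0 i.

Let rV_set0 : g_sigma_preimage rV_coord set0.
Proof. exact: sigma_algebra0. Qed.

Let rV_setC A : g_sigma_preimage rV_coord A -> g_sigma_preimage rV_coord (~` A).
Proof. exact: sigma_algebraC. Qed.

Let rV_bigcup (F : (set _)^nat) : (forall i, g_sigma_preimage rV_coord (F i)) ->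
  g_sigma_preimage rV_coord (\bigcup_i (F i)).
Proof. exact: sigma_algebra_bigcup. Qed.

HB.instance Definition _ := @isMeasurable.Build measure_rV_display
  'rV[R]_n (g_sigma_preimage rV_coord) rV_set0 rV_setC rV_bigcup.

Lemma measurable_rV_coord (i : 'I_n) : measurable_fun setT (rV_coord i).
Proof.
move=> _ Y mY; rewrite setTI; apply: sub_sigma_algebra => /=.
rewrite -bigcup_seq/=; exists i => /=; first by rewrite mem_index_enum.
by exists Y => //; rewrite setTI.
Qed.

Lemma measurable_fun_rV d (T : measurableType d) (f : T -> 'rV[R]_n) :
  (forall i, measurable_fun setT (rV_coord i \o f)) -> measurable_fun setT f.
Proof.
move=> mf _ A mA; rewrite setTI.
suff sub : g_sigma_preimage rV_coord `<=` [set B | measurable (f @^-1` B)].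
  exact: sub.
apply: smallest_sub.
  split => /=.
  - by rewrite preimage_set0; exact: measurable0.
  - by move=> B mB; rewrite setTD preimage_setC; exact: measurableC.
  - by move=> F mF; rewrite preimage_bigcup; exact: bigcupT_measurable.
rewrite -bigcup_seq; apply: bigcup_sub => i _ B [C mC <-] /=.
by rewrite setTI; have := mf i measurableT C mC; rewrite setTI.
Qed.

End measurable_rV.

Section lebesgue_rV.
Variable R : realType.

Definition cons_rV n (p : measurableTypeR R * 'rV[R]_n) : 'rV[R]_n.+1 :=
  \row_i oapp (p.2 ord0) p.1 (unlift ord0 i).

Definition uncons_rV n (v : 'rV[R]_n.+1) : measurableTypeR R * 'rV[R]_n :=
  (v ord0 ord0, \row_i v ord0 (lift ord0 i)).

Lemma cons_rVK n : cancel (@cons_rV n) (@uncons_rV n).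
Proof.
case=> a v; rewrite /uncons_rV mxE unlift_none /=; congr pair.
by apply/rowP => i; rewrite !mxE liftK.
Qed.

Lemma measurable_cons_rV n : measurable_fun setT (@cons_rV n).
Proof.
apply: measurable_fun_rV => i; case: (unliftP ord0 i) => [j ->|->].
  rewrite (_ : _ \o _ = rV_coord j \o snd); last first.
    by apply/funext => p; rewrite /= /rV_coord mxE liftK.
  by apply: measurableT_comp => //; exact: measurable_rV_coord.
rewrite (_ : _ \o _ = fst) //.
by apply/funext => p; rewrite /= /rV_coord mxE unlift_none.
Qed.

Lemma measurable_uncons_rV n : measurable_fun setT (@uncons_rV n).
Proof.
apply: measurable_fun_pair; first exact: measurable_rV_coord.
apply: measurable_fun_rV => i.
rewrite (_ : _ \o _ = rV_coord (lift ord0 i)); first exact: measurable_rV_coord.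
by apply/funext => v; rewrite /= /rV_coord mxE.
Qed.

Section step.
Variables (n : nat) (m : {sigma_finite_measure set 'rV[R]_n -> \bar R}).

Definition lebesgue_rVS : set 'rV[R]_n.+1 -> \bar R :=
  pushforward (@lebesgue_measure R \x m)%E (@cons_rV n).

Let rVS_set0 : lebesgue_rVS set0 = 0%E.
Proof. by rewrite /lebesgue_rVS /pushforward preimage_set0 measure0. Qed.

Let rVS_ge0 A : (0 <= lebesgue_rVS A)%E.
Proof. by rewrite /lebesgue_rVS /pushforward; exact: measure_ge0. Qed.

Let rVS_additive : semi_sigma_additive lebesgue_rVS.
Proof.
have mc := @measurable_cons_rV n.
move=> F mF tF mUF; rewrite /lebesgue_rVS /pushforward preimage_bigcup.
apply: measure_semi_sigma_additive.
- by move=> k; rewrite -[X in measurable X]setTI; exact: mc.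
- apply/trivIsetP => /= i j _ _ ij; rewrite -preimage_setI.
  by move/trivIsetP : tF => /(_ _ _ _ _ ij) ->//; rewrite preimage_set0.
- by rewrite -preimage_bigcup -[X in measurable X]setTI; exact: mc.
Qed.

HB.instance Definition _ :=
  isMeasure.Build _ _ _ lebesgue_rVS rVS_set0 rVS_ge0 rVS_additive.

Let rVS_sigma_finite : sigma_finite setT lebesgue_rVS.
Proof.
have /sigma_finiteP[F [TF ndF Foo]] := sigma_finiteT (@lebesgue_measure R).
have /sigma_finiteP[G [TG ndG Goo]] := sigma_finiteT m.
exists (fun k => @uncons_rV n @^-1` (F k `*` G k)).
  rewrite -preimage_bigcup (_ : \bigcup_k _ = setT) ?preimage_setT//.
  rewrite -setXTT TF TG predeqE => -[x y]; split.
    by move=> [k _ []/= ? ?]; split; exists k.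
  move=> [/= [i _ Fix] [k _ Gky]]; exists (maxn i k) => //; split.
  - by move: x Fix; exact/subsetPset/ndF/leq_maxl.
  - by move: y Gky; exact/subsetPset/ndG/leq_maxr.
move=> k; have [mF Fk] := Foo k; have [mG Gk] := Goo k; split.
  have := @measurable_uncons_rV n measurableT _ (measurableX mF mG).
  by rewrite setTI.
rewrite /lebesgue_rVS /pushforward -comp_preimage.
rewrite (_ : _ \o _ = id); last by apply/funext; exact: cons_rVK.
by rewrite preimage_id product_measure1E// lte_mul_pinfty// ge0_fin_numE.
Qed.

HB.instance Definition _ :=
  Measure_isSigmaFinite.Build _ _ _ lebesgue_rVS rVS_sigma_finite.

End step.

(* Lebesgue measure on R^n (restricted to the Borel sets) as an iterated product
   of the one-dimensional Lebesgue measure; on R^0 it is the unit mass. *)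
Fixpoint lebesgue_rV n : {sigma_finite_measure set 'rV[R]_n -> \bar R} :=
  if n is n'.+1 then lebesgue_rVS (lebesgue_rV n') else dirac (0 : 'rV[R]_0).

End lebesgue_rV.

Section polynomial_description.
Variables (R : realType) (n : nat).
Implicit Types (p : mpoly.mpoly n R) (x : 'rV[R]_n).

Definition peval p x : R := mpoly.meval (x ord0) p.

(* msize is the total degree plus one, and 0 for the zero polynomial, whose
   degree is thus at most every d. *)
Definition deg_le (d : nat) p : Prop := (mpoly.msize p <= d.+1)%N.

Definition sos p : Prop :=
  exists qs : seq (mpoly.mpoly n R), p = \sum_(q <- qs) q ^+ 2.

Definition ball_poly : mpoly.mpoly n R :=
  1 - \sum_(k < n) mpoly.mpolyX R (mpoly.mnm1 k) ^+ 2.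

Definition norm2 x : R := Num.sqrt (\sum_(i < n) x ord0 i ^+ 2).

Definition unit_ball : set 'rV[R]_n := [set x | norm2 x <= 1].

Definition semialgebraic m (g : 'I_m -> mpoly.mpoly n R) : set 'rV[R]_n :=
  [set x | forall i, 0 <= peval (g i) x].

(* The family (g_0, g_1, ..., g_m) with g_0 = 1; here g_(i+1) is g at index i. *)
Definition with_one m (g : 'I_m -> mpoly.mpoly n R) (i : 'I_m.+1) :
    mpoly.mpoly n R :=
  oapp g 1 (unlift ord0 i).

Definition quadratic_module m (g : 'I_m -> mpoly.mpoly n R) (d : nat) :
    set (mpoly.mpoly n R) :=
  [set p | exists s : 'I_m.+1 -> mpoly.mpoly n R,
     [/\ forall i, sos (s i),
         forall i, deg_le (2 * (d %/ 2))%N (with_one g i * s i) &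
         p = \sum_i with_one g i * s i]].

Definition vol (A : set 'rV[R]_n) : \bar R := lebesgue_rV R n A.

Definition sos_feasible mK (gK : 'I_mK -> mpoly.mpoly n R)
    mX (gX : 'I_mX -> mpoly.mpoly n R) (d : nat) : set (mpoly.mpoly n R) :=
  [set p | [/\ deg_le d p, quadratic_module gK d (p - 1) &
               quadratic_module gX d p]].

Definition sos_value mK (gK : 'I_mK -> mpoly.mpoly n R)
    mX (gX : 'I_mX -> mpoly.mpoly n R) (d : nat) : \bar R :=
  ereal_inf [set (\int[lebesgue_rV R n]_(x in semialgebraic gX) (peval p x)%:E)%E
            | p in sos_feasible gK gX d].

Definition indicator_majorant (K X : set 'rV[R]_n) (d : nat) :
    set (mpoly.mpoly n R) :=
  [set p | deg_le d p /\ forall x, X x -> \1_K x <= peval p x].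

Definition majorant_cost (K X : set 'rV[R]_n) p : \bar R :=
  (\int[lebesgue_rV R n]_(x in X) (peval p x - \1_K x)%:E)%E.

Definition majorant_minimizer (K X : set 'rV[R]_n) (d : nat) p : Prop :=
  indicator_majorant K X d p /\
  forall q, indicator_majorant K X d q ->
    (majorant_cost K X p <= majorant_cost K X q)%E.

Definition gibbs_constant (K X : set 'rV[R]_n) (cG : R) : Prop :=
  exists p : nat -> mpoly.mpoly n R,
    forall d, majorant_minimizer K X d (p d) /\
      forall x, X x -> peval (p d) x <= cG.

Definition inscribed_cube_ratio (K : set 'rV[R]_n) : R :=
  1 / sup [set s : R | 0 < s /\
    forall x : 'rV[R]_n, (forall i, - s <= x ord0 i <= s) -> K x].

(* The ceiling is positive whenever c1 and eps are, so that taking its absolute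
   value only serves to view it as a natural number. *)
Definition c3 (c1 eps : R) : nat := `|Num.ceil (2 * c1 / eps)|%N.

Definition degree_bound (r c1 c2 cG eps : R) : R :=
  let c := c3 c1 eps in
  c2 * expR ((3 * c%:R ^+ 2 * (3 * r * n%:R) ^+ c *
              (2 * cG * fine (vol unit_ball) + eps) / eps) `^ c2).

Definition degree_growth (r c1 c2 eps : R) : R :=
  expR (1 / eps `^ (3 * c2) * (3 * r * n%:R) `^ (2 * c1 / eps)).

End polynomial_description.

Arguments ball_poly {R n}.
Arguments unit_ball {R n}.
Arguments degree_bound {R} n.
Arguments degree_growth {R} n.

(* Main.v *)
(** The certificate is explicit and needs no Positivstellensatz.  Rescale the
    g_i of K to f_i with |f_i| <= 1/4 on the cube, and iterate
    z |-> z (1 - 2 z - 8 z^2 + 16 z^3 + 64 z^4) from z = f_i.  On u = 1 + 4 z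
    this map has the attracting fixed point 0, and the fixed point 1 attracts
    from the right and repels to the left, so u_k tends to 1 where f_i >= 0 and
    to 0 where f_i < 0.  Both z_k / z_0 and u_k / u_0 are sums of squares, hence
    p = prod_i u_{i,k}^2 is a square with p - 1 in the quadratic module of K,
    of degree O(5^k).  The iteration is only slow on the strips
    -h^N <= f_i < 0, whose volume is O(h): over each line a polynomial with
    leading coefficient bounded below is small only near the real parts of its
    complex roots.  With h ~ eps and k ~ h^-(2N+1), a degree
    exp((D / eps)^E) suffices, which the doubly exponential bound exceeds once
    c1 is large; any c2 < 1 then gives the asymptotic growth, and c2 = 1/2 is
    taken. *)
Require Import Defs.
From HB Require Import structures.
From mathcomp Require Import all_boot all_order all_algebra.
From mathcomp Require mpoly.
From mathcomp Require complex.
From mathcomp Require Import all_classical all_reals all_analysis.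
From mathcomp Require Import measurable_realfun zify ring lra.
Import (canonicals, coercions) mpoly complex.
Import Order.TTheory GRing.Theory Num.Theory.
Import numFieldNormedType.Exports.

Local Open Scope classical_set_scope.
Local Open Scope ring_scope.

(** * Sums of squares and the sharpening iteration *)

Section sos_step.
Variable A : comPzRingType.
Implicit Type z : A.

Definition sfac z := 1 - z *+ 2 - z ^+ 2 *+ 8 + z ^+ 3 *+ 16 + z ^+ 4 *+ 64.

(** The factor that [1 + z *+ 4] picks up when [z] is multiplied by [sfac z]. *)
Definition tfac z := 1 - z ^+ 2 *+ 8 + z ^+ 4 *+ 64.

Definition sharpen m z := iter m (fun y => y * sfac y) z.

Lemma sharpenS m z : sharpen m.+1 z = sharpen m z * sfac (sharpen m z).
Proof. by []. Qed.

Lemma tfacP z : 1 + (z * sfac z) *+ 4 = (1 + z *+ 4) * tfac z.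
Proof. by rewrite /sfac /tfac; ring. Qed.

(** The squares are explicit, so the same identity yields sums of squares among polynomials and
    nonnegativity over the reals. *)
Lemma sfac_sum_sqr z :
  sfac z = \sum_(q <- [:: 1 - z - z ^+ 2 *+ 5; z * (z *+ 3 + 1); z ^+ 2 *+ 5;
                          z ^+ 2 *+ 2; z ^+ 2]) q ^+ 2.
Proof. by rewrite !big_cons big_nil /sfac; ring. Qed.

Lemma tfac_sum_sqr z :
  tfac z = \sum_(q <- [:: 1 - z ^+ 2 *+ 4; z ^+ 2 *+ 4; z ^+ 2 *+ 4;
                          z ^+ 2 *+ 4]) q ^+ 2.
Proof. by rewrite !big_cons big_nil /tfac; ring. Qed.

End sos_step.

(** * Closure properties of sums of squares and of degree bounds *)

Section sos_closure.
Variables (R : realType) (n : nat).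
Implicit Types p q s : mpoly.mpoly n R.

Lemma sos_seq (qs : seq (mpoly.mpoly n R)) : sos (\sum_(q <- qs) q ^+ 2).
Proof. by exists qs. Qed.

Lemma sos_sqr p : sos (p ^+ 2).
Proof. by exists [:: p]; rewrite big_seq1. Qed.

Lemma sos0 : sos (0 : mpoly.mpoly n R).
Proof. by exists [::]; rewrite big_nil. Qed.

Lemma sos1 : sos (1 : mpoly.mpoly n R).
Proof. by rewrite -(expr1n _ 2); exact: sos_sqr. Qed.

Lemma sosD p q : sos p -> sos q -> sos (p + q).
Proof. by move=> [s ->] [t ->]; exists (s ++ t); rewrite big_cat. Qed.

Lemma sosM p q : sos p -> sos q -> sos (p * q).
Proof.
move=> [s ->] [t ->]; exists [seq x * y | x <- s, y <- t].
rewrite big_allpairs_dep /= mulr_suml; apply: eq_bigr => x _.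
by rewrite mulr_sumr; apply: eq_bigr => y _; rewrite exprMn.
Qed.

Lemma sosZ (c : R) p : 0 <= c -> sos p -> sos (c *: p).
Proof.
move=> c0 [s ->]; exists [seq Num.sqrt c *: x | x <- s].
rewrite big_map scaler_sumr; apply: eq_bigr => x _.
by rewrite exprZn sqr_sqrtr.
Qed.

Lemma deg_le_trans d e p : (d <= e)%N -> deg_le d p -> deg_le e p.
Proof. by move=> de /leq_trans; apply. Qed.

Lemma deg_le0 d : deg_le d (0 : mpoly.mpoly n R).
Proof. by rewrite /deg_le mpoly.msize0. Qed.

Lemma deg_le1 d : deg_le d (1 : mpoly.mpoly n R).
Proof. by rewrite /deg_le mpoly.msize1. Qed.

Lemma deg_leD d p q : deg_le d p -> deg_le d q -> deg_le d (p + q).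
Proof.
move=> dp dq; rewrite /deg_le.
by rewrite (leq_trans (mpoly.msizeD_le _ _))// geq_max dp dq.
Qed.

Lemma deg_leN d p : deg_le d p -> deg_le d (- p).
Proof. by rewrite /deg_le mpoly.msizeN. Qed.

Lemma deg_leMn d p k : deg_le d p -> deg_le d (p *+ k).
Proof.
by move=> dp; elim: k => [|k ih]; rewrite ?mulr0n ?mulrS;
  [exact: deg_le0 | exact: deg_leD].
Qed.

Lemma deg_leZ d (c : R) p : deg_le d p -> deg_le d (c *: p).
Proof. exact: leq_trans (mpoly.msizeZ_le _ _). Qed.

Lemma deg_leM d e p q : deg_le d p -> deg_le e q -> deg_le (d + e) (p * q).
Proof.
have [->|p0] := eqVneq p 0; first by rewrite mul0r => _ _; exact: deg_le0.
have [->|q0] := eqVneq q 0; first by rewrite mulr0 => _ _; exact: deg_le0.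
rewrite /deg_le mpoly.msizeM// => dp dq.
by have := leq_add dp dq; rewrite addSn addnS; case: (_ + _)%N.
Qed.

Lemma deg_leX d p k : deg_le d p -> deg_le (k * d) (p ^+ k).
Proof.
move=> dp; elim: k => [|k ih]; first exact: deg_le1.
by rewrite exprS mulSn; exact: deg_leM.
Qed.

Lemma deg_le_sfac d p : deg_le d p -> deg_le (4 * d) (sfac _ p).
Proof.
move=> dp.
have dk k : (k <= 4)%N -> deg_le (4 * d) (p ^+ k).
  by move=> k4; apply: deg_le_trans (deg_leX _ _ _ dp); rewrite leq_mul2r k4 orbT.
have dp4 : deg_le (4 * d) p by have := dk 1%N isT; rewrite expr1.
apply: deg_leD; [apply: deg_leD; [apply: deg_leD; [apply: deg_leD|]|]|].
- exact: deg_le1.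
- by apply/deg_leN/deg_leMn.
- by apply/deg_leN/deg_leMn/dk.
- exact/deg_leMn/dk.
- exact/deg_leMn/dk.
Qed.

Lemma deg_le_tfac d p : deg_le d p -> deg_le (4 * d) (tfac _ p).
Proof.
move=> dp.
have dk k : (k <= 4)%N -> deg_le (4 * d) (p ^+ k).
  by move=> k4; apply: deg_le_trans (deg_leX _ _ _ dp); rewrite leq_mul2r k4 orbT.
apply: deg_leD; [apply: deg_leD|].
- exact: deg_le1.
- by apply/deg_leN/deg_leMn/dk.
- exact/deg_leMn/dk.
Qed.

Lemma deg_le_sharpen d p m : deg_le d p -> deg_le (5 ^ m * d) (sharpen _ m p).
Proof.
move=> dp; elim: m => [|m ih]; first by rewrite mul1n.
rewrite sharpenS expnS -mulnA (_ : (5 * _ = 5 ^ m * d + 4 * (5 ^ m * d))%N) ?mulSn//.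
by apply: deg_leM => //; exact: deg_le_sfac.
Qed.

(** [S] and [T] are the products of [sfac] and [tfac] along the orbit. The factor added at step [m]
    has degree at most [4 * (5 ^ m * d)], so each step multiplies the degree bound by 5. *)
Lemma sharpen_sos d p m : deg_le d p -> exists S T,
  [/\ sos S /\ sos T, deg_le (5 ^ m * d) S /\ deg_le (5 ^ m * d) T,
      sharpen _ m p = p * S & 1 + sharpen _ m p *+ 4 = (1 + p *+ 4) * T].
Proof.
move=> dp; elim: m => [|m [S [T [[sS sT] [dS dT] eS eT]]]].
  exists 1, 1; rewrite !mulr1; split => //; split;
    try exact: sos1; exact: deg_le1.
have dm := deg_le_sharpen _ _ m dp.
have e5 : (5 ^ m.+1 * d = 5 ^ m * d + 4 * (5 ^ m * d))%N.
  by rewrite expnS -mulnA mulSn.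
exists (S * sfac _ (sharpen _ m p)), (T * tfac _ (sharpen _ m p)); split.
- split; apply: sosM => //.
  + by rewrite sfac_sum_sqr; exact: sos_seq.
  + by rewrite tfac_sum_sqr; exact: sos_seq.
- by rewrite e5; split; apply: deg_leM => //;
    [exact: deg_le_sfac | exact: deg_le_tfac].
- by rewrite sharpenS {1}eS mulrA.
- by rewrite sharpenS tfacP eT mulrA.
Qed.

End sos_closure.

(** * Closure properties of truncated quadratic modules *)

Section quadratic_module_closure.
Variables (R : realType) (n m : nat) (g : 'I_m -> mpoly.mpoly n R).
Implicit Types p q s : mpoly.mpoly n R.

(** Only [d %/ 2] enters the definition, so the degree may be taken even. *)
Lemma quadratic_module_half d : quadratic_module g (2 * (d %/ 2))%N = quadratic_module g d.
Proof. by rewrite /quadratic_module mulKn. Qed.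

Lemma quadratic_module0 d : quadratic_module g d 0.
Proof.
exists (fun=> 0); split=> [i|i|]; first exact: sos0.
  by rewrite mulr0; exact: deg_le0.
by rewrite big1// => i _; rewrite mulr0.
Qed.

Lemma quadratic_module_single d (j : 'I_m.+1) s :
  sos s -> deg_le (2 * (d %/ 2))%N (with_one g j * s) ->
  quadratic_module g d (with_one g j * s).
Proof.
move=> ss ds; exists (fun i => if i == j then s else 0); split=> [i|i|].
- by case: ifP => // _; exact: sos0.
- by case: ifPn => [/eqP ->//|_]; rewrite mulr0; exact: deg_le0.
- rewrite (bigD1 j)//= eqxx big1 ?addr0// => i /negPf ->.
  by rewrite mulr0.
Qed.

Lemma quadratic_module_sos d s : sos s -> deg_le (2 * (d %/ 2))%N s ->
  quadratic_module g d s.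
Proof.
move=> ss ds; have := quadratic_module_single d ord0 s ss.
by rewrite /with_one unlift_none /= mul1r; exact.
Qed.

Lemma quadratic_module_gen d (i : 'I_m) s : sos s ->
  deg_le (2 * (d %/ 2))%N (g i * s) -> quadratic_module g d (g i * s).
Proof.
move=> ss ds; have := quadratic_module_single d (lift ord0 i) s ss.
by rewrite /with_one liftK; exact.
Qed.

Lemma quadratic_moduleD d p q : quadratic_module g d p ->
  quadratic_module g d q -> quadratic_module g d (p + q).
Proof.
move=> [s [ss ds ->]] [t [st dt ->]]; exists (fun i => s i + t i); split=> [i|i|].
- exact: sosD.
- by rewrite mulrDr; exact: deg_leD.
- by rewrite -big_split/=; apply: eq_bigr => i _; rewrite mulrDr.
Qed.

Lemma quadratic_module_trans d e p : (d <= e)%N -> quadratic_module g d p ->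
  quadratic_module g e p.
Proof.
move=> de [s [ss ds ->]]; exists s; split => // i.
by apply: deg_le_trans (ds i); rewrite leq_mul2l leq_div2r ?orbT.
Qed.

Lemma quadratic_moduleM d e p s : quadratic_module g (2 * d) p ->
  sos s -> deg_le (2 * e) s -> quadratic_module g (2 * (d + e)) (p * s).
Proof.
move=> [t [st dt ->]] ss ds; exists (fun i => t i * s); split=> [i|i|].
- exact: sosM.
- by rewrite mulrA mulKn// mulnDr; apply: deg_leM => //; move: (dt i); rewrite mulKn.
- by rewrite mulr_suml; apply: eq_bigr => i _; rewrite mulrA.
Qed.

(* Telescoping: [q p - 1 = (p - 1) q + (q - 1)]. *)
Lemma quadratic_module_prod (I : Type) (r : seq I) (u : I -> mpoly.mpoly n R) e :
  (forall i, deg_le (2 * e) (u i ^+ 2)) ->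
  (forall i, quadratic_module g (2 * e) (u i ^+ 2 - 1)) ->
  deg_le (2 * (size r * e)) (\prod_(i <- r) u i ^+ 2) /\
  quadratic_module g (2 * (size r * e)) (\prod_(i <- r) u i ^+ 2 - 1).
Proof.
move=> du qu; elim: r => [|i r [dr qr]] /=.
  rewrite big_nil subrr; split; [exact: deg_le1 | exact: quadratic_module0].
rewrite big_cons; split.
  by rewrite (mulSn (size r)) mulnDr; exact: deg_leM.
set q := \prod_(j <- r) _ in dr qr *.
rewrite (_ : _ - 1 = (q - 1) * u i ^+ 2 + (u i ^+ 2 - 1)); last by ring.
apply: quadratic_moduleD.
  by rewrite (mulSn (size r)) addnC; apply: quadratic_moduleM => //; exact: sos_sqr.
by apply: quadratic_module_trans (qu i); rewrite leq_mul2l (mulSn (size r)) leq_addr.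
Qed.

Lemma quadratic_module_sharpen (i : 'I_m) (c : R) d k : 0 <= c ->
  deg_le d (g i) ->
  quadratic_module g (2 * (2 * (5 ^ k * d)))
    ((1 + sharpen _ k (c *: g i) *+ 4) ^+ 2 - 1).
Proof.
move=> c0 dg; have dcg := deg_leZ _ _ _ c _ dg.
have [S [T [[sS sT] [dS dT] eS eT]]] := sharpen_sos _ _ _ _ k dcg.
set D := (5 ^ k * d)%N in dS dT *.
have dD : (d <= D)%N by rewrite leq_pmull// expn_gt0.
have dgD := deg_le_trans _ _ _ _ _ dD dg.
set z := sharpen _ k _ in eS eT *.
(* With [u = 1 + 4 z], one has [u^2 - 1 = 4 z (1 + u)]. Inserting [z = c g S] and
   [u = (1 + 4 c g) T] leaves [g] times a sum of squares, plus a term in [g^2 S T] that is itself a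
   sum of squares. *)
have -> : (1 + z *+ 4) ^+ 2 - 1 =
    g i * ((c *+ 4) *: (S * (1 + T))) + (g i ^+ 2 * (S * T)) * ((c *+ 4) *: 1) ^+ 2.
  have -> : (1 + z *+ 4) ^+ 2 - 1 = (z *+ 4) * (1 + (1 + z *+ 4)) by ring.
  rewrite eT eS !scalerMnl -!mpoly.mul_mpolyC; ring.
have c4 : 0 <= c *+ 4 by rewrite mulrn_wge0.
apply: quadratic_moduleD.
  apply: quadratic_module_gen; first by apply/sosZ/sosM/sosD => //; exact: sos1.
  rewrite mulKn// (_ : (2 * _ = D + (D + (D + D)))%N); last by ring.
  apply: deg_leM => //; apply: deg_leZ; apply: deg_leM => //.
  apply: deg_leD; first exact: deg_le1.
  by apply: deg_le_trans dT; exact: leq_addr.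
apply: quadratic_module_sos.
  by apply: sosM; [apply: sosM; [exact: sos_sqr | exact: sosM] | exact: sos_sqr].
rewrite mulKn// (_ : (2 * _ = 2 * D + (D + D) + 2 * 0)%N); last by ring.
apply: deg_leM; last by apply/deg_leX/deg_leZ/deg_le1.
by apply: deg_leM; [exact: deg_leX | exact: deg_leM].
Qed.

End quadratic_module_closure.

(** * Pointwise bounds *)

Section sharpen_real.
Variable R : realType.
Implicit Types y z : R.

(** Right of the neutral fixed point the map lies below [x (1 - 2 x)], whose orbits decay like
    [1 / (2 m)]. *)
Lemma sharpen_nonneg m z : 0 <= z <= 4^-1 ->
  0 <= sharpen R m z /\ sharpen R m z * (m%:R + 2) *+ 2 <= 1.
Proof.
move=> /andP[z0 z1]; elim: m => [|m [ih0 ih]]; first by split => //=; lra.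
rewrite sharpenS; set x := sharpen R m z in ih0 ih *.
have m0 : (0:R) <= m%:R by [].
have x1 : x <= 4^-1 by nra.
have s0 : 0 <= sfac R x by rewrite sfac_sum_sqr sumr_ge0// => i _; exact: sqr_ge0.
split; first exact: mulr_ge0.
have sx : sfac R x <= 1 - x *+ 2.
  rewrite /sfac; have : 0 <= x ^+ 2 *+ 8 * (1 - x *+ 2 - x ^+ 2 *+ 8).
    apply: mulr_ge0; first by rewrite mulrn_wge0 ?sqr_ge0.
    nra.
  lra.
have : x * sfac R x <= x * (1 - x *+ 2) by exact: ler_wpM2l.
rewrite -natr1; move: (x * sfac R x) => w wx.
have : w * (m%:R + 1 + 2) *+ 2 <= x * (1 - x *+ 2) * (m%:R + 1 + 2) *+ 2.
  by rewrite lerMn2r/= ler_wpM2r//; lra.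
move/le_trans; apply.
(* This gives [2 x (1 - 2 x) (m + 2) <= 1 - 2 x]; adding [2 x (1 - 2 x)] on both sides leaves
   [1 - 4 x^2] on the right. *)
have : 0 <= (1 - x * (m%:R + 2) *+ 2) * (1 - x *+ 2 ) by apply: mulr_ge0; lra.
have : 0 <= x * x by rewrite mulr_ge0.
lra.
Qed.

(** The orbit moves away from 0 towards [-1/4], so the gap [y] persists and [1 + 4 z] shrinks at
    each step by a factor at most [1 - 4 y^2]. The bound [1 / (1 + 4 m y^2)] is a weak form of this
    geometric decay. *)
Lemma sharpen_nonpos m y z : 0 <= y -> - 4^-1 <= z <= - y ->
  [/\ - 4^-1 <= sharpen R m z, sharpen R m z <= - y &
      (1 + sharpen R m z *+ 4) * (1 + m%:R * (y ^+ 2 *+ 4)) <= 1].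
Proof.
move=> y0 /andP[z0 z1]; elim: m => [|m [ih0 ih ihm]].
  by split => //=; rewrite mul0r addr0 mulr1; lra.
have := tfacP _ (sharpen R m z); rewrite sharpenS.
set x := sharpen R m z in ih0 ih ihm *; set x' := x * _ => e.
have t0 : 0 <= tfac R x by rewrite tfac_sum_sqr sumr_ge0// => i _; exact: sqr_ge0.
have x2 : 0 <= x ^+ 2 by exact: sqr_ge0.
have xy : y ^+ 2 <= x ^+ 2 by rewrite -[x ^+ 2]sqrrN; apply: lerXn2r; rewrite ?nnegrE; lra.
have x16 : x ^+ 2 *+ 16 <= 1 by nra.
(* Since [16 x^2 <= 1], the quartic term is at most [4 x^2], so half of the quadratic decrease
   survives. *)
have tx : tfac R x <= 1 - y ^+ 2 *+ 4.
  rewrite /tfac; suff : x ^+ 4 *+ 64 <= x ^+ 2 *+ 4 by lra.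
  by rewrite (exprD x 2 2); nra.
have t1 : tfac R x <= 1 by have := sqr_ge0 y; lra.
have u0 : 0 <= 1 + x *+ 4 by lra.
have uu : (1 + x *+ 4) * tfac R x <= 1 + x *+ 4 by rewrite ler_piMr.
have uu0 : 0 <= (1 + x *+ 4) * tfac R x by rewrite mulr_ge0.
split; [lra|lra|].
rewrite e; apply: le_trans ihm; rewrite -mulrA ler_wpM2l//.
have y2 := sqr_ge0 y; have m0 : (0:R) <= m%:R by [].
rewrite -natr1; move: (y ^+ 2 *+ 4) (mulrn_wge0 4 y2) tx => b b0 tx.
have mb : 0 <= 1 + (m%:R + 1) * b by have := mulr_ge0 m0 b0; lra.
apply: (@le_trans _ _ ((1 - b) * (1 + (m%:R + 1) * b))); first exact: ler_wpM2r.
have := mulr_ge0 (mulr_ge0 m0 b0) b0; have := mulr_ge0 b0 b0; lra.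
Qed.

(* Replacing each complex root by its real part only shrinks the product. *)
Lemma poly_ge_prod_dist (f : {poly R}) : f != 0 -> exists s : seq R,
  size s = (size f).-1 /\
  forall t, `|lead_coef f| * \prod_(z <- s) `|t - z| <= `|f.[t]|.
Proof.
move=> f0; pose rc : {rmorphism R -> complex.complex R} := complex.real_complex R.
have [s sE] := closed_field_poly_normal (map_poly rc f).
have ls0 : lead_coef (map_poly rc f) != 0 by rewrite lead_coef_eq0 map_poly_eq0.
exists (map (@complex.Re R) s); split.
  rewrite size_map -(size_map_poly rc) sE size_scale//.
  by rewrite size_prod_XsubC.
move=> t; rewrite big_map.
have ne (x : R) : `|rc x| = rc `|x|.
  by rewrite complex.normc_def /= expr0n/= addr0 sqrtr_sqr.
rewrite -complex.lecR -[X in _ <= X]ne -horner_map sE hornerZ horner_prod normrM.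
rewrite lead_coef_map ne normr_prod rmorphM rmorph_prod.
have rc_ge0 (x : R) : 0 <= rc `|x| by rewrite -ne normr_ge0.
apply: ler_pM => //; first by apply: prodr_ge0 => z _; exact: rc_ge0.
apply: ler_prod => z _; rewrite rc_ge0 hornerXsubC.
have := complex.normc_ge_Re (rc t - z).
by rewrite raddfB.
Qed.

End sharpen_real.

(** * Volumes in the cube *)

Section cube.
Variables (R : realType) (n : nat).

(** The sup-norm ball contains the Euclidean one and, unlike it, splits as a product along the first
    coordinate. *)
Definition cube : set 'rV[R]_n := [set x | forall i, `|x ord0 i| <= 1].

Lemma measurable_forall (I : finType) d (T : measurableType d) (P : I -> set T) :
  (forall i, measurable (P i)) -> measurable [set x | forall i, P i x].
Proof.
move=> mP; rewrite (_ : [set x | _] = \bigcap_(i in setT) P i).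
  by apply: fin_bigcap_measurable => //; exact: finite_finset.
by apply/seteqP; split=> x /= h i //; exact: h.
Qed.

Lemma measurable_peval (p : mpoly.mpoly n R) :
  measurable_fun setT (peval p : _ -> measurableTypeR R).
Proof.
rewrite (_ : peval p = fun x => \sum_(m <- mpoly.msupp p)
    mpoly.mcoeff m p * \prod_i rV_coord i x ^+ mpoly.fun_of_multinom m i); last first.
  by apply/funext => x; rewrite /peval mpoly.mevalE.
apply: measurable_sum => m; apply: measurable_funM => //.
apply: measurable_prod => i _; apply: measurable_funX.
exact: measurable_rV_coord.
Qed.

Lemma measurable_cube : measurable cube.
Proof.
apply: measurable_forall => i; rewrite -[X in measurable X]setTI.
have := @measurable_rV_coord R n i measurableT [set t : R | `|t| <= 1].
apply; rewrite (_ : [set t | _] = `[-1, 1]%classic); first exact: measurable_itv.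
by apply/seteqP; split=> t /=; rewrite in_itv/= ler_norml.
Qed.

Lemma measurable_peval_ge0 (p : mpoly.mpoly n R) : measurable [set x | 0 <= peval p x].
Proof.
rewrite -[X in measurable X]setTI.
have := measurable_peval p measurableT [set t : R | 0 <= t]; apply.
rewrite (_ : [set t | _] = `[0, +oo[%classic); first exact: measurable_itv.
by apply/seteqP; split=> t /=; rewrite in_itv/= andbT.
Qed.

Lemma measurable_semialgebraic m (g : 'I_m -> mpoly.mpoly n R) :
  measurable (semialgebraic g).
Proof. by apply: measurable_forall => i; exact: measurable_peval_ge0. Qed.

Definition sublevel (p : mpoly.mpoly n R) (e : R) : set 'rV[R]_n :=
  [set x | cube x /\ `|peval p x| <= e].

Lemma measurable_sublevel p e : measurable (sublevel p e).
Proof.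
rewrite (_ : sublevel p e = cube `&` [set x | `|peval p x| <= e]); last by [].
apply: measurableI; first exact: measurable_cube.
rewrite -[X in measurable X]setTI.
have := measurable_peval p measurableT [set t : R | `|t| <= e]; apply.
rewrite (_ : [set t | _] = `[- e, e]%classic); first exact: measurable_itv.
by apply/seteqP; split=> t /=; rewrite in_itv/= ler_norml.
Qed.

Lemma unit_ball_cube : unit_ball `<=` cube.
Proof.
move=> x; rewrite /unit_ball /norm2 /= => x1 i.
rewrite -(@ler_pXn2r _ 2)// ?nnegrE// expr1n real_normK ?num_real//.
rewrite -(@ler_sqrt _ _ 1)// sqrtr1; apply: le_trans x1.
rewrite ler_sqrt ?sumr_ge0// => [|? _]; last exact: sqr_ge0.
by rewrite (bigD1 i)//= lerDl sumr_ge0// => ? _; exact: sqr_ge0.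
Qed.

Lemma peval_bounded (p : mpoly.mpoly n R) : exists2 M, 0 < M &
  forall x, cube x -> `|peval p x| <= M.
Proof.
exists (1 + \sum_(m <- mpoly.msupp p) `|mpoly.mcoeff m p|).
  by rewrite ltr_pwDl// sumr_ge0.
move=> x x1; rewrite /peval mpoly.mevalE (le_trans (ler_norm_sum _ _ _))//.
rewrite -[leLHS]add0r lerD// ler_sum// => m _.
rewrite normrM ler_piMr// normr_prod prodr_ile1// => i _.
by rewrite normr_ge0 normrX exprn_ile1.
Qed.

End cube.

(** * Volume bounds by slicing along the first coordinate *)

Section fubini_bound.
Local Open Scope ereal_scope.
Variables (R : realType) (n : nat).

Lemma cubeS (t : R) (x : 'rV[R]_n) :
  cube R n.+1 (cons_rV (t, x)) <-> (`|t| <= 1)%R /\ cube R n x.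
Proof.
split=> [h|[t1 x1] i].
  split; first by have := h ord0; rewrite mxE unlift_none.
  by move=> i; have := h (lift ord0 i); rewrite mxE liftK.
by case: (unliftP ord0 i) => [j|] ->; rewrite mxE ?liftK ?unlift_none /=.
Qed.

Lemma ysection_cons_rV (A : set 'rV[R]_n.+1) (x : 'rV[R]_n) :
  ysection (@cons_rV R n @^-1` A) x = [set t : R | A (cons_rV (t, x))].
Proof. by apply/seteqP; split=> t /=; rewrite /ysection/= inE. Qed.

Lemma measurable_preimage_cons_rV (A : set 'rV[R]_n.+1) :
  measurable A -> measurable (@cons_rV R n @^-1` A).
Proof. by move=> mA; rewrite -[X in measurable X]setTI; exact: measurable_cons_rV. Qed.

Lemma measurable_line (A : set 'rV[R]_n.+1) (x : 'rV[R]_n) : measurable A ->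
  measurable ([set t : R | A (cons_rV (t, x))] : set (measurableTypeR R)).
Proof.
by move=> /measurable_preimage_cons_rV; rewrite -ysection_cons_rV; exact: measurable_ysection.
Qed.

(** Fubini with an exceptional set: over [B] a line meets [A] inside [[-1, 1]], of length 2, and
    over the other base points in measure at most [c]. *)
Lemma lebesgue_rVS_le (A : set 'rV[R]_n.+1) (B : set 'rV[R]_n) (c : R) :
  measurable A -> measurable B -> A `<=` cube R n.+1 -> (0 <= c)%R ->
  (forall x, cube R n x -> ~ B x ->
     lebesgue_measure [set t : R | A (cons_rV (t, x))] <= c%:E) ->
  lebesgue_rV R n.+1 A <=
    2%:E * lebesgue_rV R n B + c%:E * lebesgue_rV R n (cube R n).
Proof.
move=> mA mB Acube c0 Ac.
have mA' : measurable (@cons_rV R n @^-1` A).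
  exact: measurable_preimage_cons_rV.
(* Uniqueness of the product measure permits the other order of integration, with the first
   coordinate innermost. *)
have -> : lebesgue_rV R n.+1 A =
    (@lebesgue_measure R \x^ lebesgue_rV R n) (@cons_rV R n @^-1` A).
  apply: product_measure_unique => // ? ? ? ?; exact: product_measure2E.
have mcube := measurable_cube R n.
have ind0 (D : set 'rV[R]_n) x : 0 <= (\1_D x : R)%:E by rewrite lee_fin.
have mind (D : set 'rV[R]_n) (k : R) : measurable D ->
    measurable_fun setT (fun x => k%:E * (\1_D x)%:E).
  by move=> mD; apply: measurable_funeM; exact/measurable_EFinP/measurable_indic.
have -> : 2%:E * lebesgue_rV R n B + c%:E * lebesgue_rV R n (cube R n) =
   \int[lebesgue_rV R n]_x (2%:E * (\1_B x)%:E + c%:E * (\1_(cube R n) x)%:E).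
  rewrite ge0_integralD//=; try by [exact: mind | move=> x _; rewrite mule_ge0].
  rewrite !ge0_integralZl//=; try exact/measurable_EFinP/measurable_indic.
  by rewrite !integral_indic// !setIT.
apply: ge0_le_integral => //=.
- exact: measurable_fun_ysection mA'.
- by apply: emeasurable_funD; exact: mind.
move=> x _; rewrite /= ysection_cons_rV.
have [cx|ncx] := pselect (cube R n x); last first.
  rewrite (_ : [set t | _] = set0) ?measure0; last first.
    by rewrite -subset0 => t /= /Acube/cubeS[].
  by rewrite adde_ge0// mule_ge0.
have [Bx|nBx] := pselect (B x); last first.
  by rewrite !indicE (memNset nBx) (mem_set cx) mule0 add0e mule1; exact: Ac.
rewrite [in leRHS]indicE (mem_set Bx) mule1.
apply: (@le_trans _ _ 2%:E); last by rewrite leeDl// mule_ge0.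
apply: (@le_trans _ _ (lebesgue_measure `[(-1)%R : R, 1%R]%classic)).
  apply: le_measure; rewrite ?inE//.
  - exact: measurable_line.
  - by move=> t /= /Acube/cubeS[]; rewrite in_itv/= ler_norml.
by rewrite lebesgue_measure_itv/=; case: ifP => _; rewrite -?EFinB lee_fin; lra.
Qed.

(** The preceding bound with every base point exceptional, so that [c = 0] is allowed. *)
Lemma vol_cubeS_le : lebesgue_rV R n.+1 (cube R n.+1) <= 2%:E * lebesgue_rV R n (cube R n).
Proof.
have mcube := measurable_cube R n.
have := lebesgue_rVS_le _ _ 0 (measurable_cube R n.+1) mcube.
by rewrite mul0e adde0; apply => // x.
Qed.

End fubini_bound.

Lemma vol_cube_le (R : realType) n : (lebesgue_rV R n (cube R n) <= (2 ^+ n)%:E)%E.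
Proof.
elim: n => [|n ih].
  by rewrite /= diracE mem_set// => -[].
apply: le_trans (vol_cubeS_le R n) _; rewrite exprS EFinM lee_pmul//.
Qed.

Section slice.
Variables (R : realType) (n : nat).
Implicit Types p : mpoly.mpoly n.+1 R.

(* [p], viewed as a polynomial in its first variable. *)
Definition slice p : {poly mpoly.mpoly n R} :=
  \sum_(m <- mpoly.msupp p) (mpoly.mpolyC n (mpoly.mcoeff m p))%:P *
    \prod_i (oapp (fun j => (mpoly.mpolyX R (mpoly.mnm1 j))%:P) 'X
               (unlift ord0 i)) ^+ mpoly.fun_of_multinom m i.

Definition slice_at p (x : 'rV[R]_n) : {poly R} :=
  map_poly (mpoly.meval (x ord0)) (slice p).

Lemma horner_slice_at p t (x : 'rV[R]_n) :
  (slice_at p x).[t] = peval p (cons_rV (t, x)).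
Proof.
rewrite /slice_at /slice /peval mpoly.mevalE rmorph_sum /= horner_sum.
apply: eq_bigr => m _; rewrite rmorphM /= map_polyC /= mpoly.mevalC hornerM hornerC.
congr (_ * _); rewrite rmorph_prod horner_prod; apply: eq_bigr => i _.
rewrite rmorphXn horner_exp /=; congr (_ ^+ _).
case: (unliftP ord0 i) => [j|] ->; rewrite mxE ?liftK ?unlift_none /=.
  by rewrite map_polyC/= mpoly.mevalXU hornerC.
by rewrite map_polyX hornerX.
Qed.

Lemma coef_slice_at p (x : 'rV[R]_n) k : (slice_at p x)`_k = peval (slice p)`_k x.
Proof. by rewrite coef_map. Qed.

End slice.

(** * Volume of the set where a polynomial is small *)

Section sublevel.
Variable R : realType.

Lemma uncons_rVK n : cancel (@uncons_rV R n) (@cons_rV R n).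
Proof.
move=> x; apply/rowP => i.
by case: (unliftP ord0 i) => [j|] ->; rewrite mxE ?liftK ?unlift_none /= ?mxE.
Qed.

(** If [t] had distance more than [h] from the real parts of all roots, then [f.[t]] would exceed
    [a * h ^+ (size f).-1] in absolute value. Hence intervals of length [2 h] around these real
    parts cover [A]. *)
Lemma poly_sublevel_seq (f : {poly R}) (a h : R) (A : set R) :
  0 < a -> 0 < h -> a < `|lead_coef f| -> measurable (A : set (measurableTypeR R)) ->
  (forall t, A t -> `|f.[t]| <= a * h ^+ (size f).-1) ->
  (lebesgue_measure A <= (h *+ (2 * (size f).-1))%:E)%E.
Proof.
move=> a0 h0 lf mA Af.
have f0 : f != 0 by rewrite -lead_coef_eq0 -normr_gt0 (lt_trans a0).
have [s [ss sf]] := poly_ge_prod_dist R f f0.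
pose I i : set R := `[s`_i - h, s`_i + h]%classic.
have sub : A `<=` \big[setU/set0]_(i < size s) I i.
  move=> t At; rewrite -(bigcup_mkord _ I).
  apply: contrapT => nt.
  have ht i : (i < size s)%N -> h < `|t - s`_i|.
    move=> si; rewrite ltNge; apply/negP => h1; apply: nt; exists i => //=.
    by rewrite /I/= in_itv/= -ler_distl.
  have : a * h ^+ size s < `|lead_coef f| * \prod_(z <- s) `|t - z|.
    apply: (@lt_le_trans _ _ (`|lead_coef f| * h ^+ size s)).
      by rewrite ltr_pM2r// exprn_gt0.
    rewrite ler_wpM2l// (big_nth 0) big_mkord.
    rewrite -[leLHS]mulr1 -[X in h ^+ X]card_ord -prodr_const mulr1.
    by apply: ler_prod => j _; rewrite (ltW h0) ltW ?ht.
  by move/lt_le_trans => /(_ _ (sf t)); rewrite ltNge ss Af.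
apply: (@le_trans _ _ (\sum_(i < size s) lebesgue_measure (I i))%E).
  have mI i : measurable (I i : set (measurableTypeR R)) by exact: measurable_itv.
  apply: (le_trans (le_measure lebesgue_measure _ _ sub)); rewrite ?inE//.
    by apply: bigsetU_measurable => j _; exact: mI.
  by apply: Boole_inequality => j _; exact: mI.
rewrite (eq_bigr (fun=> (h *+ 2)%:E)); last first.
  move=> i _; rewrite lebesgue_measure_itv/= lte_fin ifT; last by lra.
  by rewrite -EFinB; congr EFin; lra.
by rewrite sumEFin lee_fin sumr_const card_ord ss -mulrnA.
Qed.

(** Induction on the dimension: [p] is a polynomial in its first variable, and the points where its
    leading coefficient is small form a set of the same kind in one dimension less. *)
Lemma vol_sublevel n (p : mpoly.mpoly n R) :
  (forall x, peval p x = 0) \/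
  exists C N, 0 < C /\ forall h, 0 < h <= 1 ->
    (lebesgue_rV R n (sublevel R n p (h ^+ N)) <= (C * h)%:E)%E.
Proof.
elim: n p => [|n ih] p.
  have [p0|p0] := eqVneq (peval p 0) 0; first by left=> x; rewrite (thinmx0 x) -(thinmx0 0).
  (* In dimension 0 the measure is a unit mass, and smallness of [p] means [1 <= h / |p 0|]. *)
  right; exists `|peval p 0|^-1, 1%N; split; first by rewrite invr_gt0 normr_gt0.
  move=> h /andP[h0 h1]; rewrite expr1 /= diracE.
  have [|_] := boolP (_ \in _); last by rewrite lee_fin mulr_ge0// ltW.
  by rewrite inE => -[_]; rewrite lee_fin ler_pdivlMl ?normr_gt0// mulr1.
have [allz|] := pselect (forall k x, peval (slice R n p)`_k x = 0).
  left => x; rewrite -(uncons_rVK _ x); case: (uncons_rV x) => t y.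
  rewrite -horner_slice_at (_ : slice_at _ _ _ _ = 0) ?horner0//.
  by apply/polyP => k; rewrite coef_slice_at coef0.
move=> /existsNP[k0 kP]; right.
(* The largest [k] whose coefficient is not the zero function is the degree of every slice at which
   that coefficient does not vanish. *)
have exk : exists k, `[< exists x, peval (slice R n p)`_k x <> 0 >].
  by exists k0; apply/asboolP; exact/existsNP.
have bdk k : `[< exists x, peval (slice R n p)`_k x <> 0 >] -> (k <= size (slice R n p))%N.
  move=> /asboolP[x]; rewrite leqNgt => xk; apply/negP => /ltnW ks.
  by apply: xk; rewrite nth_default// /peval mpoly.meval0.
case: (ex_maxnP exk bdk) => k /asboolP[x0 kx0] kmax.
have {}kmax j x : (k < j)%N -> peval (slice R n p)`_j x = 0.
  move=> kj; apply: contrapT => jx; move: kj; rewrite ltnNge kmax//.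
  by apply/asboolP; exists x.
have [z|[C [N [C0 CN]]]] := ih (slice R n p)`_k; first by have := kx0 (z x0).
(* The part [2 * C] pays for base points with leading coefficient at most [h ^+ N]. Elsewhere
   [h ^+ (N + k)] is this threshold times [h ^+ k], so a slice has measure at most [2 k h], over a
   cube of volume at most [2 ^+ n]. *)
exists (2 * C + (2 * k)%:R * 2 ^+ n), (N + k)%N; split.
  by rewrite ltr_wpDr ?mulr_gt0.
move=> h h01; have /andP[h0 h1] := h01.
have hN : 0 < h ^+ N by rewrite exprn_gt0.
apply: (le_trans (lebesgue_rVS_le R n _ (sublevel R n (slice R n p)`_k (h ^+ N))
    (h *+ (2 * k)) _ _ _ _ _)).
- exact: measurable_sublevel.
- exact: measurable_sublevel.
- by move=> x [].
- by rewrite mulrn_wge0// ltW.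
- move=> x cx nBx.
  have lk : h ^+ N < `|peval (slice R n p)`_k x|.
    by rewrite ltNge; apply/negP => le; apply: nBx; split.
  have sz : size (slice_at R n p x) = k.+1.
    apply/anti_leq/andP; split.
      by apply/leq_sizeP => j kj; rewrite coef_slice_at; exact: kmax.
    rewrite ltnNge; apply/negP => /leq_sizeP/(_ k (leqnn k)).
    rewrite coef_slice_at => z; move: lk; rewrite z normr0 ltNge.
    by rewrite (ltW hN).
  have := poly_sublevel_seq (slice_at R n p x) (h ^+ N) h
    [set t | sublevel R n.+1 p (h ^+ (N + k)) (cons_rV (t, x))].
  rewrite sz /=; apply => //.
  + by rewrite lead_coefE sz coef_slice_at.
  + by apply: measurable_line; exact: measurable_sublevel.
  + by move=> t [_]; rewrite horner_slice_at exprD.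
rewrite mulrDl [leRHS]EFinD leeD//.
  by rewrite -mulrA [leRHS]EFinM lee_pmul//; exact: CN.
rewrite -[h *+ _]mulr_natl -mulrA [_ ^+ n * h]mulrC mulrA [leRHS]EFinM.
apply: lee_pmul => //; last exact: vol_cube_le.
by rewrite lee_fin mulr_ge0// ltW.
Qed.

End sublevel.

(** * The polynomial majorant of the indicator *)

Section strip.
Variables (R : realType) (n : nat).

Definition strip (p : mpoly.mpoly n R) (e : R) : set 'rV[R]_n :=
  [set x | cube R n x /\ - e <= peval p x < 0].

Lemma measurable_strip p e : measurable (strip p e).
Proof.
rewrite (_ : strip p e = cube R n `&` [set x | - e <= peval p x < 0]); last by [].
apply: measurableI; first exact: measurable_cube.
rewrite -[X in measurable X]setTI.
have := measurable_peval R n p measurableT [set t : R | - e <= t < 0]; apply.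
rewrite (_ : [set t | _] = `[- e, 0[%classic); first exact: measurable_itv.
by apply/seteqP; split=> t /=; rewrite in_itv.
Qed.

Lemma vol_strip p : exists C N, 0 < C /\ forall h, 0 < h <= 1 ->
  (lebesgue_rV R n (strip p (h ^+ N)) <= (C * h)%:E)%E.
Proof.
have [p0|[C [N [C0 CN]]]] := vol_sublevel R n p.
  (* A polynomial vanishing everywhere has empty strips, because a strip asks for strictly negative
     values. *)
  exists 1, 0%N; split=> // h /andP[h0 _].
  rewrite (_ : strip _ _ = set0) ?measure0 ?lee_fin ?mulr_ge0// ?ltW//.
  by rewrite -subset0 => x [_]; rewrite p0 ltxx andbF.
exists C, N; split=> // h h01; apply: le_trans (CN h h01).
apply: le_measure; rewrite ?inE.
- exact: measurable_strip.
- exact: measurable_sublevel.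
- move=> x [cx /andP[l u]]; split=> //.
  by rewrite ler_norml l (le_trans (ltW u))// exprn_ge0//; case/andP: h01 => /ltW.
Qed.

(** Sums serve as common upper bounds; as [h <= 1], raising the exponent only thins the strips. *)
Lemma vol_strip_uniform (m : nat) (f : 'I_m -> mpoly.mpoly n R) :
  exists C N, 0 < C /\ forall h, 0 < h <= 1 -> forall i,
    (lebesgue_rV R n (strip (f i) (h ^+ N)) <= (C * h)%:E)%E.
Proof.
have /choice[C /choice[N CN]] := fun i => vol_strip (f i).
exists (1 + \sum_i C i), (\sum_i N i)%N; split.
  by rewrite ltr_pwDl// sumr_ge0// => i _; have [/ltW] := CN i.
move=> h h01 i; have [Ci0 CNi] := CN i; have /andP[h0 h1] := h01.
apply: (@le_trans _ _ (C i * h)%:E); last first.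
  rewrite lee_fin ler_wpM2r ?(ltW h0)// (bigD1 i)//=.
  have : 0 <= \sum_(j | j != i) C j by apply: sumr_ge0 => j _; have [/ltW] := CN j.
  lra.
apply: le_trans (CNi h h01); apply: le_measure; rewrite ?inE;
  try exact: measurable_strip.
move=> x [cx /andP[l u]]; split=> //; rewrite u andbT (le_trans _ l)// lerN2.
by rewrite ler_wiXn2l ?(ltW h0)// (bigD1 i)//= leq_addr.
Qed.

End strip.

Section majorant.
Variables (R : realType) (n m : nat).
Variables (g : 'I_m -> mpoly.mpoly n R) (c : 'I_m -> R).
Hypothesis c_gt0 : forall i, 0 < c i.
Hypothesis cg_le : forall i x, cube R n x -> `|peval (c i *: g i) x| <= 4^-1.

Definition majorant k : mpoly.mpoly n R :=
  \prod_i (1 + sharpen _ k (c i *: g i) *+ 4) ^+ 2.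

Lemma sos_majorant k : sos (majorant k).
Proof.
rewrite /majorant; elim/big_ind: _ => [|p q|i _]; first exact: sos1.
  exact: sosM.
exact: sos_sqr.
Qed.

(** Each of the [m] factors contributes degree [4 * 5 ^ k * G] to the telescoped certificate. *)
Lemma majorant_deg_module k d G : (forall i, deg_le G (g i)) ->
  ((4 * m * G).+1 * 5 ^ k <= d)%N ->
  deg_le (2 * (d %/ 2)) (majorant k) /\ quadratic_module g d (majorant k - 1).
Proof.
move=> gG kd.
have [|| dm qm] := quadratic_module_prod R n m g 'I_m (index_enum 'I_m)
  (fun i => 1 + sharpen _ k (c i *: g i) *+ 4) (2 * (5 ^ k * G)).
- move=> i; apply: deg_leX.
  apply: deg_leD; first exact: deg_le1.
  apply: deg_leMn; apply: deg_le_trans (deg_le_sharpen _ _ _ _ k (deg_leZ _ _ _ (c i) _ (gG i))).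
  by rewrite leq_pmull.
- by move=> i; apply: quadratic_module_sharpen => //; exact: ltW.
have dd : (2 * (size (index_enum 'I_m) * (2 * (5 ^ k * G))) <= 2 * (d %/ 2))%N.
  have -> : size (index_enum 'I_m) = m by rewrite -sum1_size big_const_ord iter_addn mul1n addn0.
  have k0 : (0 < 5 ^ k)%N by rewrite expn_gt0.
  rewrite leq_mul2l /= leq_divRL//.
  by apply: leq_trans kd; rewrite mulSn; nia.
split; first exact: deg_le_trans dm.
by rewrite -quadratic_module_half; apply: quadratic_module_trans qm.
Qed.

Lemma peval_sharpen k (p : mpoly.mpoly n R) x :
  peval (1 + sharpen _ k p *+ 4) x = 1 + sharpen R k (peval p x) *+ 4.
Proof.
rewrite /peval rmorphD rmorph1 rmorphMn; congr (_ + _ *+ _).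
elim: k => //= k ih; rewrite -!/(sharpen _ _ _).
rewrite rmorphM /= ih; congr (_ * _).
by rewrite /sfac !(rmorphD, rmorphN, rmorph1, rmorphMn, rmorphXn) /= ih.
Qed.

Lemma peval_majorant k x : peval (majorant k) x =
  \prod_i (1 + sharpen R k (peval (c i *: g i) x) *+ 4) ^+ 2.
Proof.
rewrite /majorant {1}/peval rmorph_prod; apply: eq_bigr => i _.
by rewrite rmorphXn /= -/(peval _ _) peval_sharpen.
Qed.

(** The chord of a convex function, with values 1 at [t = 0] and [4 ^+ j] at [t = 1]. *)
Lemma expr_1D3_le (t : R) j : 0 <= t <= 1 -> (1 + 3 * t) ^+ j <= 1 + (4 ^+ j - 1) * t.
Proof.
move=> /andP[t0 t1]; elim: j => [|j ih]; first by rewrite !expr0; lra.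
rewrite !exprS; have a1 : 1 <= 4 ^+ j :> R by rewrite exprn_ege1//; lra.
move: (4 ^+ j) a1 ih => a a1 ih.
apply: le_trans (ler_wpM2l _ ih) _; first lra.
have : 0 <= (a - 1) * t * (1 - t) by rewrite !mulr_ge0//; lra.
lra.
Qed.

Lemma sharpen_cube k i x : cube R n x ->
  0 <= 1 + sharpen R k (peval (c i *: g i) x) *+ 4 <= 1 + 2 / (k%:R + 2).
Proof.
move=> cx; have := cg_le i x cx; rewrite ler_norml => /andP[z0 z1].
have k2 : 0 < k%:R + 2 :> R by rewrite ltr_wpDl.
have t0 : 0 <= 2 / (k%:R + 2) :> R by rewrite divr_ge0// ltW.
set z := peval _ _ in z0 z1 *; have [zp|zn] := leP 0 z.
  have [|s0 s1] := sharpen_nonneg R k z; first by rewrite zp.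
  have : sharpen R k z *+ 4 <= 2 / (k%:R + 2).
    by rewrite ler_pdivlMr//; lra.
  lra.
have [||s0 s1 _] := sharpen_nonpos R k 0 z; [by []|by rewrite z0 oppr0 ltW|].
lra.
Qed.

(** Three cases. On the semialgebraic set all factors are at most [1 + 3 t] with [t <= 2 h]. On a
    strip the crude bound [4 ^+ m] is paid by the indicator of the strip. Elsewhere some factor is
    at most [h] and each other one at most 4. *)
Lemma majorant_le k h N x : cube R n x -> 0 < h <= 1 -> 1 <= k%:R * h ^+ (2 * N).+1 ->
  peval (majorant k) x <= \1_(semialgebraic g) x +
    4 ^+ m * (3 * h + \sum_i \1_(strip R n (c i *: g i) (h ^+ N)) x).
Proof.
move=> cx /andP[h0 h1] kh.
have k2 : 0 < k%:R + 2 :> R by rewrite ltr_wpDl.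
set t : R := 2 / (k%:R + 2).
have kh1 : 1 <= k%:R * h.
  apply: le_trans kh _; rewrite ler_wpM2l// exprS ler_piMr ?(ltW h0)//.
  by rewrite exprn_ile1// ltW.
have t0 : 0 <= t by rewrite divr_ge0// ltW.
have th : t <= 2 * h by rewrite ler_pdivrMr//; lra.
have t1 : t <= 1 by rewrite ler_pdivrMr// mul1r lerDr.
have u_le i : 0 <= 1 + sharpen R k (peval (c i *: g i) x) *+ 4 <= 1 + t.
  exact: sharpen_cube.
have u2_le i : 0 <= (1 + sharpen R k (peval (c i *: g i) x) *+ 4) ^+ 2 <= 1 + 3 * t.
  have /andP[u0 u1] := u_le i; rewrite sqr_ge0 /= expr2; nra.
have a1 : 1 <= 4 ^+ m :> R by rewrite exprn_ege1//; lra.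
have p_le : peval (majorant k) x <= 1 + (4 ^+ m - 1) * t.
  rewrite peval_majorant; apply: le_trans (expr_1D3_le _ m _); last by rewrite t0.
  by rewrite -[X in _ ^+ X]card_ord -prodr_const; apply: ler_prod.
have S0 (P : pred 'I_m) : 0 <= \sum_(i | P i) \1_(strip R n (c i *: g i) (h ^+ N)) x :> R.
  exact: sumr_ge0.
have [Kx|nKx] := pselect (semialgebraic g x).
  rewrite indicE mem_set//=; apply: le_trans p_le _; rewrite lerD2l.
  have := mulr_ge0 (le_trans ler01 a1) (S0 xpredT).
  have := ler_wpM2l (le_trans ler01 a1) th; have := mulr_ge0 (le_trans ler01 a1) (ltW h0).
  lra.
rewrite indicE memNset// add0r.
move/existsNP: nKx => [i /negP]; rewrite -ltNge => gi.
have zi : peval (c i *: g i) x < 0 by rewrite /peval mpoly.mevalZ pmulr_rlt0.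
have [near|far] := leP (- h ^+ N) (peval (c i *: g i) x).
  rewrite (bigD1 i)//= indicE mem_set//; last by split => //; rewrite near.
  apply: le_trans p_le _; rewrite mulr1n; have := S0 (predC1 i); move: (\sum_(j | _) _) => S S_ge0.
  have a0 : 0 <= 4 ^+ m :> R by exact: le_trans a1.
  have := mulr_ge0 a0 S_ge0; have := mulr_ge0 a0 (ltW h0).
  have : (4 ^+ m - 1) * t <= 4 ^+ m - 1 by rewrite ler_piMr// subr_ge0.
  lra.
rewrite peval_majorant (bigD1 i)//=.
have y0 : 0 <= h ^+ N by rewrite exprn_ge0// ltW.
have := cg_le i x cx; rewrite ler_norml => /andP[z0 _].
have [|s0 s1 s2] := sharpen_nonpos R k _ (peval (c i *: g i) x) y0.
  by rewrite z0 ltW.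
have /andP[u0 _] := u_le i.
(* By the decay estimate with [y = h ^+ N], the factor is at most [1 / (1 + 4 k h^(2N))], and
   [k h^(2N)] is at least [1 / h]. *)
have {s2} uh : 1 + sharpen R k (peval (c i *: g i) x) *+ 4 <= h.
  move: (1 + _ *+ 4) u0 s2 => u u0 s2.
  have ky : 1 <= k%:R * (h ^+ N) ^+ 2 * h by rewrite -exprM muln2 -mul2n -mulrA -exprSr.
  have := ler_wpM2r (ltW h0) s2; have := ler_wpM2l u0 ky; nra.
have {s0 s1} u1 : (1 + sharpen R k (peval (c i *: g i) x) *+ 4) ^+ 2 <= h.
  by rewrite expr2 (le_trans _ uh)// ler_piMr// (le_trans uh).
have pr : \prod_(j | j != i) (1 + sharpen R k (peval (c j *: g j) x) *+ 4) ^+ 2 <= 4 ^+ m.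
  apply: (@le_trans _ _ (\prod_(j | j != i) 4)).
    apply: ler_prod => j _; have /andP[-> /=] := u2_le j; move/le_trans; apply; lra.
  rewrite prodr_const ler_weXn2l//; first lra.
  by rewrite -[X in (_ <= X)%N]card_ord max_card.
apply: (@le_trans _ _ (h * 4 ^+ m)).
  by apply: ler_pM => //; [exact: sqr_ge0 | apply: prodr_ge0 => j _; exact: sqr_ge0].
have := mulr_ge0 (le_trans ler01 a1) (S0 xpredT).
have := mulr_ge0 (le_trans ler01 a1) (ltW h0); lra.
Qed.

End majorant.

(** The majorant is feasible: being a sum of squares, it lies in the module of [gX] through the
    multiplier of [g_0 = 1]. Integrating its pointwise bound makes each strip cost [O(h)]. *)
Lemma sos_value_le (R : realType) (n nK nX : nat)
    (gK : 'I_nK -> mpoly.mpoly n R) (gX : 'I_nX -> mpoly.mpoly n R) :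
  semialgebraic gX `<=` unit_ball ->
  exists (D : nat) (C : R) (N : nat), 0 < C /\ forall k h d,
    0 < h <= 1 -> 1 <= k%:R * h ^+ (2 * N).+1 -> (D * 5 ^ k <= d)%N ->
    (sos_value gK gX d <= vol (semialgebraic gK) + (C * h)%:E)%E.
Proof.
move=> XB; set K := semialgebraic gK; set X := semialgebraic gX in XB *.
have Xcube : X `<=` cube R n by apply: subset_trans XB _; exact: unit_ball_cube.
have mX : measurable X by exact: measurable_semialgebraic.
have mK : measurable K by exact: measurable_semialgebraic.
have /choice[c cP] : forall i : 'I_nK, exists c : R, 0 < c /\
    forall x, cube R n x -> `|peval (c *: gK i) x| <= 4^-1.
  move=> i; have [M M0 MP] := peval_bounded R n (gK i).
  exists (4 * M)^-1; split; first by rewrite invr_gt0 mulr_gt0.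
  move=> x cx; rewrite /peval mpoly.mevalZ normrM gtr0_norm ?invr_gt0 ?mulr_gt0//.
  by rewrite invfM -mulrA ler_piMr ?invr_ge0// ler_pdivrMl// mulr1 MP.
have c_gt0 i : 0 < c i by have [] := cP i.
have cg_le i x : cube R n x -> `|peval (c i *: gK i) x| <= 4^-1.
  by have [_] := cP i; exact.
have [C [N [C0 CN]]] := vol_strip_uniform R n nK (fun i => c i *: gK i).
pose G := (\sum_i mpoly.msize (gK i))%N.
have degG i : deg_le G (gK i).
  by rewrite /deg_le leqW// /G (bigD1 i)//= leq_addr.
(* Here [3 * 2 ^+ n] comes from the constant [3 * h] over a set of volume at most [2 ^+ n], and
   [nK%:R * C] from the strips. *)
exists (4 * nK * G).+1, (4 ^+ nK * (3 * 2 ^+ n + nK%:R * C)), N; split.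
  by rewrite mulr_gt0// ltr_pwDl ?mulr_ge0 ?mulr_gt0// ltW.
move=> k h d h01 kh kd.
have [dp qp] := majorant_deg_module R n nK gK c c_gt0 k d G degG kd.
set p := majorant R n nK gK c k in dp qp.
have h0 : 0 <= h by case/andP: h01 => /ltW.
have volX : (lebesgue_rV R n X <= (2 ^+ n)%:E)%E.
  apply: le_trans (vol_cube_le R n); apply: le_measure; rewrite ?inE//.
  exact: measurable_cube.
have p0 x : 0 <= peval p x.
  by rewrite peval_majorant prodr_ge0// => i _; exact: sqr_ge0.
apply: (@le_trans _ _ (\int[lebesgue_rV R n]_(x in X) (peval p x)%:E)%E).
  apply: ereal_inf_lbound; exists p => //; split => //.
    by apply: deg_le_trans dp; lia.
  by apply: quadratic_module_sos => //; exact: sos_majorant.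
pose S i := strip R n (c i *: gK i) (h ^+ N).
have mS i : measurable (S i) by exact: measurable_strip.
have mind (D E : set 'rV[R]_n) : measurable D ->
    measurable_fun E (fun x => (\1_D x : R)%:E).
  by move=> mD; exact/measurable_EFinP/measurable_indic.
have mp : measurable_fun X (fun x => (peval p x)%:E).
  apply/measurable_EFinP; apply: measurable_funTS; exact: measurable_peval.
have mcst : measurable_fun X (fun x : 'rV[R]_n => (3 * h)%:E) by exact: measurable_cst.
have msum : measurable_fun X (fun x => \sum_(i < nK) (\1_(S i) x : R)%:E)%E.
  by apply: emeasurable_sum => i; exact: mind.
have S0 x : (0 <= \sum_(i < nK) (\1_(S i) x : R)%:E)%E.
  by apply: sume_ge0 => i _; rewrite lee_fin.
have h30 : (0 <= (3 * h)%:E)%E by rewrite lee_fin mulr_ge0.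
have m4 : (0 <= (4 ^+ nK : R)%:E)%E by rewrite lee_fin.
apply: (@le_trans _ _ (\int[lebesgue_rV R n]_(x in X) ((\1_K x : R)%:E +
    (4 ^+ nK : R)%:E * ((3 * h)%:E + \sum_(i < nK) (\1_(S i) x : R)%:E)))%E).
  apply: ge0_le_integral => //.
  - by move=> x _; rewrite lee_fin.
  - apply: emeasurable_funD; first exact: mind.
    by apply: measurable_funeM; exact: emeasurable_funD.
  - move=> x Xx; rewrite sumEFin -!EFinD lee_fin.
    by apply: majorant_le => //; exact: Xcube.
rewrite ge0_integralD//; last 3 first.
- exact: mind.
- by move=> x _; rewrite mule_ge0// adde_ge0.
- by apply: measurable_funeM; exact: emeasurable_funD.
rewrite integral_indic// leeD//.
  by apply: le_measure; rewrite ?inE//; exact: measurableI.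
rewrite ge0_integralZl//; last 2 first.
- exact: emeasurable_funD.
- by move=> x _; rewrite adde_ge0.
rewrite -[X in (_ <= X%:E)%E]mulrA [leRHS]EFinM lee_pmul//.
  by apply: integral_ge0 => x _; rewrite adde_ge0.
rewrite ge0_integralD// integral_cst// ge0_integral_sum//; last by move=> i; exact: mind.
rewrite [X in (_ <= X%:E)%E]mulrDl [leRHS]EFinD leeD//.
  rewrite -[X in (_ <= X%:E)%E]mulrA [X in (_ <= (_ * X)%:E)%E]mulrC.
  by rewrite [X in (_ <= X%:E)%E]mulrA [leRHS]EFinM lee_pmul.
apply: (@le_trans _ _ (\sum_(i < nK) (C * h)%:E)%E).
  apply: lee_sum => i _; rewrite integral_indic//.
  apply: le_trans (CN h h01 i).
  by apply: le_measure; rewrite ?inE//; [exact: measurableI | exact: mS].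
by rewrite sumEFin lee_fin sumr_const card_ord -mulrA mulr_natl.
Qed.

(** * Degree sufficient for a prescribed accuracy *)

Section rate.
Variables (R : realType) (n nK nX : nat).
Variables (gK : 'I_nK -> mpoly.mpoly n R) (gX : 'I_nX -> mpoly.mpoly n R).
Hypothesis KB : semialgebraic gK `<=` unit_ball.
Hypothesis XB : semialgebraic gX `<=` unit_ball.

Lemma vol_le_cube (A : set 'rV[R]_n) : measurable A -> A `<=` unit_ball ->
  (vol A <= (2 ^+ n)%:E)%E.
Proof.
move=> mA AB; apply: le_trans (vol_cube_le R n); apply: le_measure; rewrite ?inE//.
  exact: measurable_cube.
by apply: subset_trans AB _; exact: unit_ball_cube.
Qed.

Lemma sos_value_rate : exists (D : R) (E : nat), 1 <= D /\
  forall eps d, 0 < eps <= 1 -> expR ((D / eps) ^+ E.+1) <= d%:R ->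
    (sos_value gK gX d < vol (semialgebraic gK) + eps%:E)%E.
Proof.
have [D0 [C [N [C0 CN]]]] := sos_value_le R n nK nX gK gX XB.
have D1 : (1 : R) <= D0%:R + 8 by have : 0 <= D0%:R :> R by []; lra.
(* With [h = eps / (2 (C + 1))] the quotient [D / eps] becomes [(D0 + 8) / h]; the summand 8 absorbs
   [4 k <= 4 (M + 1) <= 8 M]. *)
exists ((D0%:R + 8) * (2 * (C + 1))), (2 * N)%N; split; first nra.
move=> eps d /andP[e0 e1] hd.
have C1 : 0 < 2 * (C + 1) by lra.
pose h := eps / (2 * (C + 1)).
have h0 : 0 < h by rewrite divr_gt0.
have h1 : h <= 1 by rewrite ler_pdivrMr//; lra.
have Ch : C * h < eps by rewrite mulrA ltr_pdivrMr//; nra.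
have hi : h^-1 = 2 * (C + 1) / eps by rewrite invf_div.
have hM : 0 < h ^+ (2 * N).+1 by rewrite exprn_gt0.
set M := h ^- (2 * N).+1.
have M1 : 1 <= M by rewrite invf_ge1// exprn_ile1// ltW.
have [k k1 k2] : exists2 k : nat, M <= k%:R & k%:R <= M + 1.
  exists (Num.truncn M).+1.
    by apply/ltW/truncnS_gt.
  by rewrite -natr1 lerD2r truncn_le; lra.
apply: (@le_lt_trans _ _ (vol (semialgebraic gK) + (C * h)%:E)%E); last first.
  rewrite lteD2lE ?lte_fin// ge0_fin_numE//.
  apply: le_lt_trans (ltry (2 ^+ n)); apply: vol_le_cube.
    exact: measurable_semialgebraic.
  exact: KB.
apply: (CN k h d); first by rewrite h0.
  by rewrite -ler_pdivrMr// mul1r.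
rewrite -(ler_nat R); apply: le_trans hd; rewrite natrM natrX.
have -> : (D0%:R + 8) * (2 * (C + 1)) / eps = (D0%:R + 8) * h^-1 by rewrite hi !mulrA.
rewrite exprMn exprVn -/M.
(* Both [D0 <= expR D0] and [5 <= expR 4] are instances of [1 + x <= expR x]. *)
apply: (@le_trans _ _ (expR (D0%:R + k%:R * 4))).
  rewrite expRD expRM_natl; apply: ler_pM => //.
    by apply: le_trans (expR_ge1Dx _); rewrite lerDr.
  by rewrite lerXn2r ?nnegrE ?expR_ge0//; apply: le_trans (expR_ge1Dx _); lra.
rewrite ler_expR; apply: (@le_trans _ _ ((D0%:R + 8) * M)).
  have : D0%:R * 1 <= D0%:R * M by rewrite ler_wpM2l.
  lra.
by rewrite ler_wpM2r ?(le_trans _ M1)// ler_eXnr.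
Qed.

(** The constant polynomial 1 is feasible in every degree. *)
Lemma sos_value_le_vol d : (sos_value gK gX d <= vol (semialgebraic gX))%E.
Proof.
apply: (@le_trans _ _ (\int[lebesgue_rV R n]_(x in semialgebraic gX) (peval 1 x)%:E)%E).
  apply: ereal_inf_lbound; exists 1 => //; split; first exact: deg_le1.
    by rewrite subrr; exact: quadratic_module0.
  by apply: quadratic_module_sos; [exact: sos1 | exact: deg_le1].
rewrite (eq_integral (cst 1%E)) => [|x _]; last by rewrite /peval mpoly.meval1.
by rewrite integral_cst ?mul1e//; exact: measurable_semialgebraic.
Qed.

(** Extends the rate to all [eps]: above [2 ^+ n] the volume of the outer set already suffices, and
    below it the rate is applied to [eps / 2 ^+ n], whence the new constant. *)
Lemma sos_value_expR_rate : exists (D : R) (E : nat), 1 <= D /\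
  forall eps d, 0 < eps ->
    (eps <= D -> expR ((D / eps) ^+ E.+1) <= d%:R) ->
    (sos_value gK gX d - vol (semialgebraic gK) < eps%:E)%E.
Proof.
have [D [E [D1 DE]]] := sos_value_rate.
have V1 : 1 <= 2 ^+ n :> R by rewrite exprn_ege1//; lra.
exists (D * 2 ^+ n), E; split; first nra.
have mK : measurable (semialgebraic gK) by exact: measurable_semialgebraic.
have mX : measurable (semialgebraic gX) by exact: measurable_semialgebraic.
have Kfin : vol (semialgebraic gK) \is a fin_num.
  by rewrite ge0_fin_numE//; exact: le_lt_trans (vol_le_cube _ mK KB) (ltry _).
move=> eps d e0 hd; rewrite lteBlDl//.
have [eV|Ve] := leP eps (2 ^+ n); last first.
  apply: le_lt_trans (sos_value_le_vol d) _.
  apply: le_lt_trans (vol_le_cube _ mX XB) _.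
  apply: (@lt_le_trans _ _ eps%:E); first by rewrite lte_fin.
  by rewrite leeDr.
have V0 : 0 < 2 ^+ n :> R by lra.
apply: (@lt_le_trans _ _ (vol (semialgebraic gK) + (eps / 2 ^+ n)%:E)%E).
  apply: DE; first by rewrite divr_gt0// ler_pdivrMr// mul1r.
  by rewrite invf_div mulrA; apply: hd; nra.
by rewrite leeD2l// lee_fin ler_pdivrMr// ler_peMr// ltW.
Qed.
End rate.

(** * Comparison with the degree bound *)

(** A positive dimension provides a coordinate that forces [s <= 1], and the interior point makes
    the supremum positive, which keeps the quotient from the default value 0. *)
Lemma inscribed_cube_ratio_ge1 (R : realType) (n : nat) (K : set 'rV[R]_n) :
  (0 < n)%N -> K `<=` unit_ball -> (K°)%classic 0 -> 1 <= inscribed_cube_ratio K.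
Proof.
move=> n0 KB K0; rewrite /inscribed_cube_ratio; set S := [set s | _].
have S1 : ubound S 1.
  move=> s [s0 sK].
  have := sK (const_mx s); have le_s (i : 'I_n) : - s <= (const_mx s : 'rV[R]_n) ord0 i <= s.
    by rewrite mxE; lra.
  move=> /(_ le_s) /KB /unit_ball_cube /(_ (Ordinal n0)).
  by rewrite mxE gtr0_norm.
have [s Ss s0] : exists2 s, S s & 0 < s.
  move: K0 => /nbhs_ballP[e /= e0 eK].
  exists (e / 2); last by rewrite divr_gt0.
  split; first by rewrite divr_gt0.
  move=> x xe; apply: eK; split=> // i j; rewrite (ord1 i) mxE /ball /= sub0r normrN.
  apply: (@le_lt_trans _ _ (e / 2)); first by rewrite ler_norml; exact: xe.
  by rewrite ltr_pdivrMr//; move: (e0 : 0 < e); lra.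
have sup0 : 0 < sup S by apply: lt_le_trans s0 _; apply: ub_le_sup => //; exists 1.
by rewrite ler_pdivlMr// mul1r; apply: ge_sup => //; exists s.
Qed.

(** At the origin the indicator is 1, and the majorant lies between it and [cG]. *)
Lemma gibbs_constant_ge0 (R : realType) (n : nat) (K X : set 'rV[R]_n) cG :
  K `<=` X -> K 0 -> gibbs_constant K X cG -> 0 <= cG.
Proof.
move=> KX K0 [p /(_ 0%N)[[[_ pK] _] pX]].
apply: le_trans (pX 0 (KX _ K0)); apply: le_trans (pK 0 (KX _ K0)).
by [].
Qed.

Section degree_bound.
Variable R : realType.

Lemma c3_itv (c1 eps : R) : 0 < c1 -> 0 < eps ->
  2 * c1 / eps <= (c3 c1 eps)%:R <= 2 * c1 / eps + 1 /\ (0 < c3 c1 eps)%N.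
Proof.
move=> c0 e0; have x0 : 0 < 2 * c1 / eps by rewrite divr_gt0// mulr_gt0.
have z0 : 0 < Num.ceil (2 * c1 / eps) by rewrite ceil_gt0.
have /andP[l u] := ceil_itv (2 * c1 / eps).
rewrite /c3 natr_absz gtr0_norm// absz_gt0 gt_eqF//; split=> //.
by rewrite u /=; move: l; rewrite intrD; lra.
Qed.

(** Turns the power [3 ^+ c] into an exponential; it follows from [1 - 1/2 <= expR (- 1/2)]. *)
Lemma expR_half_le3 : expR (2^-1 : R) <= 3.
Proof.
have := expR_ge1Dx (- 2^-1 : R); rewrite expRN.
have e0 := expR_gt0 (2^-1 : R).
move=> /(ler_wpM2r (ltW e0)); rewrite mulVf ?gt_eqF//; lra.
Qed.

(** The base [A] of the inner power is at least [3 ^+ c], hence at least [expR (c1 / eps)]. A single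
    Taylor term of order [2 * E.+1] then beats the square of [2 (D / eps)^(E+1)]; the factorial in
    [c1] cancels its denominator. *)
Lemma degree_bound_ge n (D c1 r cG eps : R) E : (0 < n)%N -> 1 <= r -> 0 <= cG ->
  1 <= D -> 0 < eps <= D -> c1 = 4 * (2 * E.+1)`!%:R * D ->
  expR ((D / eps) ^+ E.+1) <= degree_bound n r c1 2^-1 cG eps.
Proof.
move=> n0 r1 cG0 D1 /andP[e0 eD] c1E; rewrite /degree_bound.
have F1 : 1 <= (2 * E.+1)`!%:R :> R by rewrite ler1n fact_gt0.
have c10 : 0 < c1 by rewrite c1E !mulr_gt0//; lra.
have [/andP[cl _] c0] := c3_itv _ _ c10 e0.
set c := c3 c1 eps in cl c0 *; set V := fine _.
have V0 : 0 <= V by exact: fine_ge0.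
set A := (3 * _ ^+ 2 * _ * _ / eps : R).
have q3 : 3 <= 3 * r * n%:R.
  have : 1 <= n%:R :> R by rewrite ler1n.
  nra.
have A3 : 3 ^+ c <= A.
  rewrite /A ler_pdivlMr//.
  have c2 : 1 <= c%:R ^+ 2 :> R by rewrite exprn_ege1// ler1n.
  have qc : 3 ^+ c <= (3 * r * n%:R) ^+ c by rewrite lerXn2r// nnegrE; lra.
  have c30 : 0 <= 3 ^+ c :> R by rewrite exprn_ge0.
  have cGV : 0 <= cG * V by rewrite mulr_ge0.
  apply: ler_pM => //; [exact: ltW| |lra].
  by rewrite -[leLHS]mul1r; apply: ler_pM => //; lra.
have Ae : expR (c%:R / 2) <= A.
  apply: le_trans A3; rewrite expRM_natl lerXn2r ?nnegrE ?expR_ge0//.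
  exact: expR_half_le3.
have De : 1 <= D / eps by rewrite ler_pdivlMr// mul1r.
have De0 : 0 <= D / eps by lra.
have AD : (2 * (D / eps) ^+ E.+1) ^+ 2 <= A.
  apply: le_trans Ae.
  have x0 : 0 <= c1 / eps by rewrite divr_ge0// ltW.
  apply: (@le_trans _ _ (expR (c1 / eps))); last first.
    rewrite ler_expR; move: cl; rewrite -mulrA; lra.
  have := expR_ge1Dxn (2 * E.+1).-1 x0; rewrite prednK//; apply: le_trans.
  rewrite ler_wpDl// ler_pdivlMr ?ltr0n ?fact_gt0//.
  rewrite c1E -mulrA [X in _ <= X]exprMn exprMn -exprM (mulnC E.+1).
  rewrite mulrAC ler_wpM2r ?exprn_ge0//.
  rewrite (_ : 2 ^+ 2 * _ = 4 * (2 * E.+1)`!%:R); last by ring.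
  by rewrite ler_eXnr//; lra.
have A0 : 0 <= A by apply: le_trans AD; exact: sqr_ge0.
have sq : 2 * (D / eps) ^+ E.+1 <= A `^ 2^-1.
  rewrite powR12_sqrt// -[leLHS]ger0_norm ?mulr_ge0 ?exprn_ge0//.
  by rewrite -sqrtr_sqr ler_sqrt.
have p1 : 1 <= (D / eps) ^+ E.+1 by rewrite exprn_ege1.
(* The factor 2 gained in the exponent gives room for one more unit there, and [expR 1 >= 2] offsets
   the prefactor [c2 = 2^-1]. *)
apply: (@le_trans _ _ (2^-1 * expR ((D / eps) ^+ E.+1 + 1))).
  have := expR_ge1Dx (1 : R); have := expR_gt0 ((D / eps) ^+ E.+1).
  rewrite expRD; nra.
by rewrite ler_wpM2l// ler_expR; lra.
Qed.

(** As [c2 = 1/2], the exponent is the square root of [A], while [A] is at most [B * Y / eps ^+ 3].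
    Once [Y] exceeds the constant [B], the root is at most [Y / eps^(3/2)]. *)
Lemma degree_bound_growth n (r c1 cG : R) : (0 < n)%N -> 1 <= r -> 0 <= cG ->
  0 < c1 ->
  (degree_bound n r c1 2^-1 cG : R -> R) =O_ (0^'+) (degree_growth n r c1 2^-1).
Proof.
move=> n0 r1 cG0 c10; apply/eqO_exP; exists 2^-1 => //.
set V := fine (vol (@unit_ball R n)).
have V0 : 0 <= V by exact: fine_ge0.
have q3 : 3 <= 3 * r * n%:R.
  have : 1 <= n%:R :> R by rewrite ler1n.
  nra.
set q := 3 * r * n%:R in q3 *.
have L0 : 0 < ln q by rewrite ln_gt0//; lra.
have cGV : 0 <= 2 * cG * V by rewrite !mulr_ge0.
(* From [c * eps <= 3 * c1] comes [3 * 9 * c1 ^+ 2], from rounding up in the exponent one factor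
   [q], and from [eps <= 1] the last summand. *)
pose B := 27 * c1 ^+ 2 * q * (2 * cG * V + 1).
have B0 : 0 <= B.
  by rewrite !mulr_ge0 ?sqr_ge0//; lra.
near=> eps.
have e0 : 0 < eps by near: eps; exact: nbhs_right_gt.
have e1 : eps <= 1 by near: eps; exact: nbhs_right_le.
have ec : eps <= c1 by near: eps; exact: nbhs_right_le.
(* This threshold yields [B <= Y] through [1 + x <= expR x] at [x = (2 c1 / eps) ln q]. *)
have eB : eps <= 2 * c1 * ln q / (B + 1).
  by near: eps; apply: nbhs_right_le; rewrite divr_gt0 ?mulr_gt0//; lra.
rewrite /degree_bound /degree_growth -/V -/q.
have [/andP[_ cu] c0] := c3_itv _ _ c10 e0.
set c := c3 c1 eps in cu c0 *; set A := (3 * _ ^+ 2 * _ * _ / eps : R).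
rewrite !ger0_norm ?mulr_ge0 ?expR_ge0// ler_wpM2l// ler_expR.
set Y := q `^ _.
have Y0 : 0 < Y by rewrite powR_gt0; lra.
have YB : B <= Y.
  rewrite /Y /powR gt_eqF; last lra.
  apply: le_trans (expR_ge1Dx _).
  move: eB; rewrite ler_pdivlMr; last lra.
  move=> eB; rewrite ler_wpDl//.
  by rewrite mulrAC ler_pdivlMr//; nra.
have qc : q ^+ c <= q * Y.
  rewrite -powR_mulrn; last lra.
  rewrite /Y -{2}[q]powRr1; last lra.
  rewrite -powRD; last by apply/implyP => _; rewrite gt_eqF//; lra.
  by apply: ler_powR; lra.
have cE : c%:R * eps <= 3 * c1.
  have := ler_wpM2r (ltW e0) cu; rewrite mulrDl divfK ?gt_eqF//; lra.
have ce2 : c%:R ^+ 2 * eps ^+ 2 <= 9 * c1 ^+ 2.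
  rewrite -exprMn (_ : 9 * _ = (3 * c1) ^+ 2); last by ring.
  by rewrite lerXn2r ?nnegrE//; rewrite mulr_ge0// ltW.
have q0 : 0 <= q ^+ c by rewrite exprn_ge0//; lra.
have A0 : 0 <= A.
  by rewrite divr_ge0 ?(ltW e0)// !mulr_ge0 ?sqr_ge0// addr_ge0// ltW.
have Ae : A * eps ^+ 3 <= B * Y.
  rewrite (_ : A * eps ^+ 3 = 3 * (c%:R ^+ 2 * eps ^+ 2) * q ^+ c * (2 * cG * V + eps)).
    rewrite /B.
    rewrite (_ : _ * Y = 3 * (9 * c1 ^+ 2) * (q * Y) * (2 * cG * V + 1)); last by ring.
    apply: ler_pM; rewrite ?mulr_ge0 ?sqr_ge0 ?addr_ge0 ?(ltW e0)//; last lra.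
    by apply: ler_pM => //; rewrite ?mulr_ge0 ?sqr_ge0// ler_wpM2l.
  rewrite /A; field; lra.
have W : eps `^ (3 * 2^-1) ^+ 2 = eps ^+ 3.
  rewrite -powR_mulrn ?powR_ge0// -powRrM -powR_mulrn ?(ltW e0)//.
  by congr (_ `^ _); field.
have w0 : 0 < eps `^ (3 * 2^-1) by rewrite powR_gt0.
rewrite powR12_sqrt// div1r.
have wY0 : 0 <= (eps `^ (3 * 2^-1))^-1 * Y by rewrite mulr_ge0 ?invr_ge0// ltW.
rewrite -[leRHS]ger0_norm// -sqrtr_sqr ler_sqrt ?sqr_ge0//.
rewrite exprMn exprVn W mulrC ler_pdivlMr ?exprn_gt0//.
by apply: le_trans Ae _; rewrite expr2 ler_wpM2r// ltW.
Unshelve. all: by end_near.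
Qed.

End degree_bound.

Theorem theorem4 (R : realType) (n : nat) (n_gt0 : (0 < n)%N)
    (nK : nat) (gK : 'I_nK -> mpoly.mpoly n R)
    (nX : nat) (gX : 'I_nX -> mpoly.mpoly n R)
    (K X : set 'rV[R]_n)
    (KE : K = semialgebraic gK) (XE : X = semialgebraic gX)
    (cptK : compact K) (cptX : compact X)
    (KX : K `<=` X) (XB : X `<=` unit_ball)
    (gK_ball : exists i, gK i = ball_poly)
    (gX_ball : exists i, gX i = ball_poly)
    (K0 : (K°)%classic 0)
    (gibbs : exists cG, gibbs_constant K X cG) :
  exists c1 c2 : R, [/\ 0 < c1, 0 < c2 &
    forall cG, gibbs_constant K X cG ->
      let r := inscribed_cube_ratio K in
      (forall eps : R, 0 < eps -> forall d : nat,
         degree_bound n r c1 c2 cG eps <= d%:R ->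
         (sos_value gK gX d - vol K < eps%:E)%E) /\
      (degree_bound n r c1 c2 cG : R -> R) =O_ (0^'+) (degree_growth n r c1 c2)].
Proof.
have KB : K `<=` unit_ball by exact: subset_trans KX XB.
have r1 := inscribed_cube_ratio_ge1 R n K n_gt0 KB K0.
have [D [E [D1 DE]]] := sos_value_expR_rate R n nK nX gK gX
  ltac:(by rewrite -KE) ltac:(by rewrite -XE).
pose c1 := 4 * (2 * E.+1)`!%:R * D.
have c10 : 0 < c1 by rewrite !mulr_gt0 ?ltr0n ?fact_gt0//; lra.
(* [D] and [E] come from the two descriptions alone, so [c1] is fixed before [cG] is given. *)
exists c1, 2^-1; split=> // cG gG r.
have cG0 := gibbs_constant_ge0 R n K X cG KX (interior_subset K0) gG.
split; last exact: degree_bound_growth.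
move=> eps e0 d hd; rewrite KE; apply: DE => // eD.
by apply: le_trans hd; apply: degree_bound_ge => //; rewrite e0.
Qed.
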